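(* Let $G$ be a finite-dimensional Lie group with Lie algebra $\mathfrak{g}$ acting on the left on a manifold $M$, let $a_{\rm ref}\in M$, and let $\ell:\mathfrak{g}\times\operatorname{Orb}(a_{\rm ref})\times\mathbb{R}\to\mathbb{R}$, $f^{\rm ext},f^{\rm fr}:\mathfrak{g}\times\operatorname{Orb}(a_{\rm ref})\times\mathbb{R}\to\mathfrak{g}^*$, $p_H^{\rm ext}:\mathfrak{g}\times\operatorname{Orb}(a_{\rm ref})\times\mathbb{R}\to\mathbb{R}$ be the reduced maps associated with a $G_{a_{\rm ref}}$-invariant Lagrangian $L_{a_{\rm ref}}:TG\times\mathbb{R}\to\mathbb{R}$, fiber-preserving $G_{a_{\rm ref}}$-equivariant external and friction forces $F^{\rm ext}_{a_{\rm ref}},F^{\rm fr}_{a_{\rm ref}}:TG\times\mathbb{R}\to T^*G$, and a $G_{a_{\rm ref}}$-invariant external heat power $P^{\rm ext}_{H,a_{\rm ref}}:TG\times\mathbb{R}\to\mathbb{R}$. Let $\mathcal{C}$ be a manifold on which $G$ acts on the left, let $\mathcal{K}:\mathcal{C}\times\operatorname{Orb}(a_{\rm ref})\to\mathfrak{g}^{**}\cong\mathfrak{g}$ be a $G$-equivariant map, and define the Kelvin–Noether quantity $I:\mathcal{C}\times\mathfrak{g}\times\operatorname{Orb}(a_{\rm ref})\times\mathbb{R}\to\mathbb{R}$ by $$I(c,\xi,a,S)=\Big\langle\mathcal{K}(c,a),\frac{\partial\ell}{\partial\xi}(\xi,a,S)\Big\rangle.$$ Fix $c_{\rm ref}\in\mathcal{C}$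 and let $(g,\xi,a,S)$ be a curve with $g(t)\in G$, $\xi=g^{-1}\dot g$, $a=g^{-1}a_{\rm ref}$, $S(t)\in\mathbb{R}$, satisfying $$\frac{d}{dt}\frac{\partial\ell}{\partial\xi}(\xi,a,S)=\operatorname{ad}^*_\xi\frac{\partial\ell}{\partial\xi}(\xi,a,S)-\mathbf{J}\Big(\frac{\partial\ell}{\partial a}(\xi,a,S)\Big)+f^{\rm ext}(\xi,a,S)+f^{\rm fr}(\xi,a,S),$$ $$\frac{\partial\ell}{\partial S}(\xi,a,S)\,\dot S=\langle f^{\rm fr}(\xi,a,S),\xi\rangle-p^{\rm ext}_H(\xi,a,S),\qquad \dot a+\xi_M(a)=0.$$ Let $c=g^{-1}c_{\rm ref}$. Then along the curve (that is, for $I=I(c(t),\xi(t),a(t),S(t))$) $$\frac{dI}{dt}=\Big\langle\mathcal{K}(c,a),-\mathbf{J}\Big(\frac{\partial\ell}{\partial a}(\xi,a,S)\Big)+(f^{\rm ext}+f^{\rm fr})(\xi,a,S)\Big\rangle.$$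
   Context: All maps and curves are smooth. $G_{a_{\rm ref}}\subset G$ is the isotropy subgroup of $a_{\rm ref}$ and $\operatorname{Orb}(a_{\rm ref})\subset M$ its $G$-orbit; actions are written by concatenation. For $\xi\in\mathfrak{g}$, $\xi_M(x)=\frac{d}{ds}\big|_{s=0}\exp(s\xi)x$ is the infinitesimal generator on $M$. For $(g,\dot g)\in TG$, $g^{-1}\dot g:=T_gL_{g^{-1}}\dot g\in\mathfrak{g}$. A map $F:TG\times\mathbb{R}\to T^*G$ is fiber-preserving if $F(g,\dot g,S)\in T_g^*G$. A map $\Phi:TG\times\mathbb{R}\to\mathbb{R}$ is $G_{a_{\rm ref}}$-invariant if $\Phi(gh,g\dot h,S)=\Phi(h,\dot h,S)$ for all $g\in G_{a_{\rm ref}}$, $(h,\dot h)\in TG$, $S\in\mathbb{R}$; its reduced map is defined by $\varphi(g^{-1}\dot g,g^{-1}a_{\rm ref},S)=\Phi(g,\dot g,S)$. A fiber-preserving map $\Phi:TG\times\mathbb{R}\to T^*G$ is $G_{a_{\rm ref}}$-equivariant if $\Phi(gh,g\dot h,S)=g\,\Phi(h,\dot h,S)$ for all $g\in G_{a_{\rm ref}}$ (cotangent-lifted left translation); its reduced map is $\varphi(g^{-1}\dot g,g^{-1}a_{\rm ref},S)=g^{-1}\Phi(g,\dot g,S)\in\mathfrak{g}^*$, where $\langle g^{-1}\alpha_g,\eta\rangle=\langle\alpha_g,T_eL_g\eta\rangle$. $\operatorname{ad}^*_\xi$ is given by $\langle\operatorname{ad}^*_\xi\mu,\eta\rangle=\langle\mu,[\xi,\eta]\rangle$.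 $\mathbf{J}:T^*M\to\mathfrak{g}^*$ is the momentum map $\langle\mathbf{J}(\alpha_x),\xi\rangle=\langle\alpha_x,\xi_M(x)\rangle$; the same formula defines $\mathbf{J}(\partial\ell/\partial a)$ since $\xi_M(a)$ is tangent to $\operatorname{Orb}(a_{\rm ref})$. The action of $G$ on $\mathfrak{g}^{**}\cong\mathfrak{g}$ is the dual of the coadjoint action of $G$ on $\mathfrak{g}^*$, so equivariance of $\mathcal{K}$ means $\mathcal{K}(gc,ga)=\operatorname{Ad}_g\mathcal{K}(c,a)$ for all $g\in G$, $c\in\mathcal{C}$, $a\in\operatorname{Orb}(a_{\rm ref})$. *)

(* Defs.v *)
From HB Require Import structures.
From mathcomp Require Import all_boot all_order all_algebra.
From mathcomp Require Import all_classical all_reals all_analysis.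
Set Implicit Arguments.
Unset Strict Implicit.
Unset Printing Implicit Defensive.
Import Order.TTheory GRing.Theory Num.Theory.
Import numFieldNormedType.Exports.
Local Open Scope classical_set_scope.
Local Open Scope ring_scope.

(* Groups with a topology; continuity of the operations is not part of the
   structure (for a Lie group it follows from their smoothness). *)
#[short(type="preTopologicalGroupType")]
HB.structure Definition PreTopologicalGroup :=
  {G of Group G & Topological G}.

(* [Ck_on k U f]: f is of class C^k at every point of the open set U. The model
   spaces are all finite dimensional, hence C^{k+1} means differentiable with
   all directional derivatives of class C^k. *)
Fixpoint Ck_on (R : realType) (V W : normedModType R) (k : nat) (U : set V)
    (f : V -> W) : Prop :=
  match k with
  | 0 => forall x, U x -> {for x, continuous f}
  | k'.+1 => (forall x, U x -> differentiable f x) /\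
             (forall v : V, Ck_on k' U ('D_v f))
  end.

Definition smooth_on (R : realType) (V W : normedModType R) (U : set V)
    (f : V -> W) : Prop :=
  open U /\ forall k, Ck_on k U f.

(* A chart of T with values in V; [cmap] and [cinv] are total functions that
   are only meaningful on [csrc] and [ctgt]. *)
Record chart (R : realType) (V : normedModType R) (T : Type) := Chart {
  csrc : set T;
  ctgt : set V;
  cmap : T -> V;
  cinv : V -> T }.

HB.instance Definition _ (R : realType) (V : normedModType R) (T : Type) :=
  gen_eqMixin (chart V T).
HB.instance Definition _ (R : realType) (V : normedModType R) (T : Type) :=
  gen_choiceMixin (chart V T).

(* The chosen chart [chart_at A x] around x identifies the tangent space T_xT
   with the model space V: throughout, a tangent vector at x is given by its
   coordinates in [chart_at A x]. *)
Record atlas (R : realType) (V : normedModType R) (T : Type) := Atlas {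
  charts : set (chart V T);
  chart_at : T -> chart V T }.

Definition transition (R : realType) (V : normedModType R) (T : Type)
    (c d : chart V T) : V -> V :=
  fun y => cmap d (cinv c y).

Definition is_chart (R : realType) (V : normedModType R) (T : Type)
    (c : chart V T) : Prop :=
  [/\ open (ctgt c),
      forall x, csrc c x -> ctgt c (cmap c x) /\ cinv c (cmap c x) = x &
      forall y, ctgt c y -> csrc c (cinv c y) /\ cmap c (cinv c y) = y].

Definition is_manifold (R : realType) (V : normedModType R)
    (T : topologicalType) (A : atlas V T) : Prop :=
  [/\ hausdorff_space T /\ @second_countable T,
      forall x, charts A (chart_at A x) /\ csrc (chart_at A x) x,
      forall c, charts A c -> is_chart c,
      forall c, charts A c -> [/\ open (csrc c),
        forall x, csrc c x -> {for x, continuous (cmap c)} &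
        forall y, ctgt c y -> {for y, continuous (cinv c)}] &
      forall c d, charts A c -> charts A d ->
        smooth_on (ctgt c `&` cinv c @^-1` csrc d) (transition c d)].

(* The openness contained in [smooth_on] says that f is continuous on D. *)
Definition smooth_map_on (R : realType) (V W : normedModType R) (T U : Type)
    (A : atlas V T) (B : atlas W U) (D : set T) (f : T -> U) : Prop :=
  forall c d, charts A c -> charts B d ->
    smooth_on (ctgt c `&` cinv c @^-1` (D `&` f @^-1` csrc d))
              (fun y => cmap d (f (cinv c y))).

Definition smooth_map (R : realType) (V W : normedModType R) (T U : Type)
    (A : atlas V T) (B : atlas W U) (f : T -> U) : Prop :=
  smooth_map_on A B setT f.

Definition vec_atlas (R : realType) (V : normedModType R) : atlas V V :=
  let c := Chart setT setT (@id V) (@id V) in Atlas [set c] (fun=> c).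

Definition prod_chart (R : realType) (V W : normedModType R) (T U : Type)
    (c : chart V T) (d : chart W U) : chart (V * W)%type (T * U)%type :=
  Chart (csrc c `*` csrc d) (ctgt c `*` ctgt d)
        (fun p => (cmap c p.1, cmap d p.2))
        (fun q => (cinv c q.1, cinv d q.2)).

Definition prod_atlas (R : realType) (V W : normedModType R) (T U : Type)
    (A : atlas V T) (B : atlas W U) : atlas (V * W)%type (T * U)%type :=
  Atlas [set e | exists c d, [/\ charts A c, charts B d & e = prod_chart c d]]
        (fun p => prod_chart (chart_at A p.1) (chart_at B p.2)).

(* [tangent_map A B f x v] is T_x f (v). *)
Definition tangent_map (R : realType) (V W : normedModType R) (T U : Type)
    (A : atlas V T) (B : atlas W U) (f : T -> U) (x : T) (v : V) : W :=
  'd (fun y => cmap (chart_at B (f x)) (f (cinv (chart_at A x) y)))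
     (cmap (chart_at A x) x) v.

Definition velocity (R : realType) (V : normedModType R) (T : Type)
    (A : atlas V T) (f : R -> T) (t : R) : V :=
  derive1 (fun s => cmap (chart_at A (f t)) (f s)) t.

(* The tangent bundle of T is T * V. A chart c of T induces the chart
   (x, v) |-> (c(x), T_x c (v)). *)
Definition tangent_chart (R : realType) (V : normedModType R) (T : Type)
    (A : atlas V T) (c : chart V T) : chart (V * V)%type (T * V)%type :=
  Chart (csrc c `*` setT) (ctgt c `*` setT)
    (fun p : T * V => let d := chart_at A p.1 in
              (cmap c p.1, 'd (transition d c) (cmap d p.1) p.2))
    (fun q : V * V => let x := cinv c q.1 in
              (x, 'd (transition c (chart_at A x)) (q.1) q.2)).

Definition tangent_atlas (R : realType) (V : normedModType R) (T : Type)
    (A : atlas V T) : atlas (V * V)%type (T * V)%type :=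
  Atlas (tangent_chart A @` charts A)
        (fun p => tangent_chart A (chart_at A p.1)).

(* The dual of 'rV[R]_n is 'cV[R]_n, paired by matrix product. *)
Definition pairing (R : realType) (n : nat) (alpha : 'cV[R]_n) (v : 'rV[R]_n)
    : R := (v *m alpha) 0 0.

(* For a linear form f, the covector alpha with pairing alpha v = f v. *)
Definition covector (R : realType) (n : nat) (f : 'rV[R]_n -> R) : 'cV[R]_n :=
  \col_i f (delta_mx 0 i).

(* The cotangent bundle of T is T * 'cV[R]_n. A chart c of T induces
   (x, alpha) |-> (c(x), (T_x c)^{-1*} alpha). *)
Definition cotangent_chart (R : realType) (n : nat) (T : Type)
    (A : atlas 'rV[R]_n T) (c : chart 'rV[R]_n T)
    : chart ('rV[R]_n * 'cV[R]_n)%type (T * 'cV[R]_n)%type :=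
  Chart (csrc c `*` setT) (ctgt c `*` setT)
    (fun p : T * 'cV[R]_n => let d := chart_at A p.1 in
       (cmap c p.1,
        covector (fun w => pairing p.2 ('d (transition c d) (cmap c p.1) w))))
    (fun q : 'rV[R]_n * 'cV[R]_n => let x := cinv c q.1 in let d := chart_at A x in
       (x, covector (fun w => pairing q.2 ('d (transition d c) (cmap d x) w)))).

Definition cotangent_atlas (R : realType) (n : nat) (T : Type)
    (A : atlas 'rV[R]_n T)
    : atlas ('rV[R]_n * 'cV[R]_n)%type (T * 'cV[R]_n)%type :=
  Atlas (cotangent_chart A @` charts A)
        (fun p => cotangent_chart A (chart_at A p.1)).

(* The bracket [X, Y](x) = DY.X - DX.Y of vector fields, computed in the chart
   [chart_at A x]; [chart_rep] is the local representative of a vector field. *)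
Definition chart_rep (R : realType) (V : normedModType R) (T : Type)
    (A : atlas V T) (c : chart V T) (X : T -> V) : V -> V :=
  fun y => (cmap (tangent_chart A c) (cinv c y, X (cinv c y))).2.

Definition vf_bracket (R : realType) (V : normedModType R) (T : Type)
    (A : atlas V T) (X Y : T -> V) (x : T) : V :=
  let c := chart_at A x in
  'd (chart_rep A c Y) (cmap c x) (chart_rep A c X (cmap c x)) -
  'd (chart_rep A c X) (cmap c x) (chart_rep A c Y (cmap c x)).

Section LieGroup.
Context (R : realType) (n : nat) (G : preTopologicalGroupType).
Variable A : atlas 'rV[R]_n G.
Local Open Scope group_scope.

Definition is_lie_group : Prop :=
  [/\ is_manifold A,
      smooth_map (prod_atlas A A) A (fun p : G * G => p.1 * p.2) &
      smooth_map A A (fun g : G => g^-1)].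

(* T_h L_g (v) *)
Definition ltrans (g h : G) (v : 'rV[R]_n) : 'rV[R]_n :=
  tangent_map A A (fun k : G => g * k) h v.

(* The Lie algebra is T_eG = 'rV[R]_n with the bracket of left invariant
   vector fields. *)
Definition lie_bracket (xi eta : 'rV[R]_n) : 'rV[R]_n :=
  vf_bracket A (fun g => ltrans g 1 xi) (fun g => ltrans g 1 eta) 1.

Definition Ad (g : G) (eta : 'rV[R]_n) : 'rV[R]_n :=
  tangent_map A A (fun h : G => g * h * g^-1) 1 eta.

Definition ad_star (xi : 'rV[R]_n) (mu : 'cV[R]_n) : 'cV[R]_n :=
  covector (fun eta => pairing mu (lie_bracket xi eta)).

Definition one_parameter_subgroup (xi : 'rV[R]_n) (gamma : R -> G) : Prop :=
  [/\ smooth_map (vec_atlas R^o) A gamma,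
      forall s t : R, gamma (s + t)%R = gamma s * gamma t &
      velocity A gamma 0%R = xi].

(* [xget] picks the unique one-parameter subgroup generated by xi. *)
Definition lie_exp (xi : 'rV[R]_n) : G :=
  xget (fun=> 1) [set gamma : R -> G | one_parameter_subgroup xi gamma] 1%R.

(* g^{-1} alpha_g, i.e. <g^{-1} alpha_g, eta> = <alpha_g, T_e L_g eta> *)
Definition cotangent_to_dual (g : G) (alpha : 'cV[R]_n) : 'cV[R]_n :=
  covector (fun eta => pairing alpha (ltrans g 1 eta)).

(* Cotangent lift of L_g, from T*_h G to T*_{gh} G:
   <g alpha_h, w> = <alpha_h, T_{gh} L_{g^{-1}} w> *)
Definition cotangent_lift (g h : G) (alpha : 'cV[R]_n) : 'cV[R]_n :=
  covector (fun w => pairing alpha (ltrans g^-1 (g * h) w)).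

End LieGroup.

Record left_action (G : groupType) (X : Type) := LeftAction {
  act :> G -> X -> X;
  act1 : forall x, act 1%g x = x;
  actM : forall g h x, act (g * h)%g x = act g (act h x) }.

Definition smooth_action (R : realType) (n : nat) (V : normedModType R)
    (G : preTopologicalGroupType) (X : Type) (AG : atlas 'rV[R]_n G)
    (AX : atlas V X) (phi : left_action G X) : Prop :=
  smooth_map (prod_atlas AG AX) AX (fun p : G * X => phi p.1 p.2).

(* xi_X(x) *)
Definition generator (R : realType) (n : nat) (V : normedModType R)
    (G : preTopologicalGroupType) (X : Type) (AG : atlas 'rV[R]_n G)
    (AX : atlas V X) (phi : left_action G X) (xi : 'rV[R]_n) (x : X) : V :=
  velocity AX (fun s : R => phi (lie_exp AG (s *: xi)) x) 0.

Definition momentum_map (R : realType) (n m : nat)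
    (G : preTopologicalGroupType) (X : Type) (AG : atlas 'rV[R]_n G)
    (AX : atlas 'rV[R]_m X) (phi : left_action G X) (x : X)
    (alpha : 'cV[R]_m) : 'cV[R]_n :=
  covector (fun xi => pairing alpha (generator AG AX phi xi x)).

Section Orbit.
Context (G : groupType) (M : Type) (phi : left_action G M) (a : M).

Definition orbit_type : Type := {x : M | exists g, phi g a = x}.

Definition orbit_pt (g : G) : orbit_type :=
  exist _ (phi g a) (ex_intro _ g erefl).

Definition orbit_fun (g : G) (o : orbit_type) : orbit_type :=
  exist _ (phi g (sval o))
    (let: ex_intro h e := svalP o in
     ex_intro _ (g * h)%g (etrans (actM phi g h a) (congr1 (phi g) e))).

Fact orbit_fun1 (o : orbit_type) : orbit_fun 1%g o = o.
Proof.
apply: eq_sig_hprop => [x p q|]; first exact: Prop_irrelevance.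
by rewrite /= act1.
Qed.

Fact orbit_funM (g h : G) (o : orbit_type) :
  orbit_fun (g * h)%g o = orbit_fun g (orbit_fun h o).
Proof.
apply: eq_sig_hprop => [x p q|]; first exact: Prop_irrelevance.
by rewrite /= actM.
Qed.

Definition orbit_action : left_action G orbit_type :=
  LeftAction orbit_fun1 orbit_funM.

Definition isotropy : set G := [set g | phi g a = a].

End Orbit.

Section OrbitAtlas.
Context (R : realType) (n m : nat) (G : preTopologicalGroupType) (M : Type).
Variables (AG : atlas 'rV[R]_n G) (AM : atlas 'rV[R]_m M).
Variables (phi : left_action G M) (a : M).

(* The rank of xi |-> xi_M(a). *)
Definition orbit_dim : nat :=
  \rank (lin1_mx (fun xi : 'rV[R]_n => generator AG AM phi xi a)).

(* The smooth structure of the orbit is the one carried over from G / G_a: its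
   charts are those for which the orbit map g |-> g a is a smooth submersion.
   (It need not be the one induced by the topology of M.) *)
Definition orbit_chart : set (chart 'rV[R]_orbit_dim (orbit_type phi a)) :=
  [set c |
    let U := [set g | csrc c (orbit_pt phi a g)] in
    let f := fun g => cmap c (orbit_pt phi a g) in
    let AV := vec_atlas 'rV[R]_orbit_dim in
    [/\ is_chart c, smooth_map_on AG AV U f &
        forall g, U g -> forall w, exists v, tangent_map AG AV f g v = w]].

Definition orbit_atlas : atlas 'rV[R]_orbit_dim (orbit_type phi a) :=
  Atlas orbit_chart
    (fun o => xget (Chart set0 set0 (fun=> 0) (fun=> o))
                   [set c | orbit_chart c /\ csrc c o]).

End OrbitAtlas.

Section Reduction.
Context (R : realType) (n : nat) (G : preTopologicalGroupType) (M : Type).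
Variables (AG : atlas 'rV[R]_n G) (phi : left_action G M) (a : M).

Definition TGR_atlas := prod_atlas (tangent_atlas AG) (vec_atlas R^o).

Definition invariant_map (Phi : G * 'rV[R]_n * R -> R) : Prop :=
  forall g h v s, isotropy phi a g ->
    Phi ((g * h)%g, ltrans AG g h v, s) = Phi (h, v, s).

Definition reduced_map (Phi : G * 'rV[R]_n * R -> R)
    (f : 'rV[R]_n * orbit_type phi a * R -> R) : Prop :=
  forall g v s,
    f (ltrans AG g^-1%g g v, orbit_pt phi a g^-1%g, s) = Phi (g, v, s).

Definition fiber_preserving (F : G * 'rV[R]_n * R -> G * 'cV[R]_n) : Prop :=
  forall g v s, (F (g, v, s)).1 = g.

Definition equivariant_force (F : G * 'rV[R]_n * R -> G * 'cV[R]_n) : Prop :=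
  forall g h v s, isotropy phi a g ->
    F ((g * h)%g, ltrans AG g h v, s) =
    ((g * h)%g, cotangent_lift AG g h (F (h, v, s)).2).

Definition reduced_force (F : G * 'rV[R]_n * R -> G * 'cV[R]_n)
    (f : 'rV[R]_n * orbit_type phi a * R -> 'cV[R]_n) : Prop :=
  forall g v s,
    f (ltrans AG g^-1%g g v, orbit_pt phi a g^-1%g, s) =
    cotangent_to_dual AG g (F (g, v, s)).2.

End Reduction.

Section PartialDerivatives.
Context (R : realType) (n m : nat) (X : Type).
Variables (AX : atlas 'rV[R]_m X) (l : 'rV[R]_n * X * R -> R).

Definition partial_xi (xi : 'rV[R]_n) (x : X) (s : R) : 'cV[R]_n :=
  covector ('d (fun eta => l (eta, x, s) : R^o) xi).

(* An element of T*_x X *)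
Definition partial_a (xi : 'rV[R]_n) (x : X) (s : R) : 'cV[R]_m :=
  covector (tangent_map AX (vec_atlas R^o) (fun y => l (xi, y, s)) x).

Definition partial_S (xi : 'rV[R]_n) (x : X) (s : R) : R :=
  derive1 (fun u : R => l (xi, x, u) : R^o) s.

End PartialDerivatives.

Definition kelvin_noether (R : realType) (n : nat) (C X : Type)
    (l : 'rV[R]_n * X * R -> R) (K : C * X -> 'rV[R]_n)
    (c : C) (xi : 'rV[R]_n) (x : X) (s : R) : R :=
  pairing (partial_xi l xi x s) (K (c, x)).

(* Main.v *)
Require Import Defs.
From HB Require Import structures.
From mathcomp Require Import all_boot all_order all_algebra.
From mathcomp Require Import all_classical all_reals all_analysis.
Set Implicit Arguments.
Unset Strict Implicit.
Unset Printing Implicit Defensive.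
Import Order.TTheory GRing.Theory Num.Theory.
Import numFieldNormedType.Exports.
Local Open Scope classical_set_scope.
Local Open Scope ring_scope.

(** Since the points [c] and [a] are the translates of [c_ref] and [a_ref] by
    [g^-1], equivariance gives [K (c, a) = Ad (g^-1) kappa] with a constant
    [kappa]. Hence, with [mu] the derivative of [l] in [xi],
    [I = <mu, Ad (g^-1) kappa>] is the pairing of a curve whose derivative is
    prescribed by the equation of motion with a curve on an adjoint orbit. The
    latter satisfies
      [d/dt Ad (g^-1) kappa = - [xi, Ad (g^-1) kappa]],
    for [xi = g^-1 g'] ([is_derive_Ad_inv]), and the resulting term
    [- <mu, [xi, K]>] cancels the pairing of [ad*_xi mu] with [K]; the momentum
    map and the forces remain.

    The derivative of the adjoint action is computed in a chart around the unit.
    Multiplicativity of [Ad] ([AdM]) reduces it to a curve through the unit. Let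
    [m] be the group law in the chart, [D_1] and [D_2] its partial derivatives.
    The bracket of left invariant vector fields is
      [[u, v] = D_1 D_2 m (u; v) - D_1 D_2 m (v; u)]
    at the unit ([lie_bracketE]), while [Ad (h^-1) v = D_2 m (h^-1, h) w] with
    [w = D_1 m (1, h) v] the right translate of [v]. Differentiating along a
    curve [h] with velocity [u], the first factor contributes
    [- D_1 D_2 m (u; v)] and the second [D_2 D_1 m (v; u)]. That the order of
    the two derivatives may be exchanged is Schwarz's theorem
    ([mixed_derivatives]), which follows from the mean value theorem. *)

(** * Symmetry of second derivatives *)

Lemma near_eq_differentiable (R : numFieldType) (V W : normedModType R)
    (f g : V -> W) (x : V) :
  {near x, f =1 g} -> differentiable f x -> differentiable g x.
Proof.
move=> fg df.
have gx : g x = f x by rewrite (nbhs_singleton fg).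
have gE : g \o shift x = cst (g x) + 'd f x +o_ 0 id.
  have /eqaddoP fo := diff_locally df.
  apply/eqaddoP => e e0.
  have sfg : \forall h \near 0, f (h + x) = g (h + x).
    by move: fg; rewrite (near_shift 0) /= subr0.
  by have := fo _ e0; apply: filterS2 sfg => h fgh /=; rewrite !fctE /= -fgh gx.
have dc : continuous ('d f x) by exact: diff_continuous.
by apply/diff_locallyP; rewrite (diff_unique dc gE).
Qed.

(** Restricting a map to a line turns directional derivatives into ordinary
    ones, to which the mean value theorem applies. *)
Lemma is_derive_along (R : realType) (V W : normedModType R)
    (f : V -> W) (x v : V) (r : R) (df : W) :
  is_derive (x + r *: v) v f df -> is_derive r 1 (fun s => f (x + s *: v)) df.
Proof.
have E : (fun h : R => h^-1 *: (((fun s => f (x + s *: v)) \o shift r) (h *: 1)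
       - f (x + r *: v))) =
   (fun h : R => h^-1 *: ((f \o shift (x + r *: v)) (h *: v) - f (x + r *: v))).
  apply/funext => h /=; congr (_ *: (f _ - _)).
  by rewrite [_%:A]mulr1 scalerDl addrCA.
move=> [c d]; apply: DeriveDef; first by rewrite /derivable E.
by rewrite /derive E.
Qed.

(** The mean value theorem is applied first to the difference
    [r |-> f (x + s v + r u) - f (x + r u)], then to [fu] along [v]. *)
Lemma second_difference (R : realType) (V : normedModType R) (U : set V)
    (f fu fuv : V -> R) (x u v : V) (s : R) : 0 < s ->
  (forall y, U y -> is_derive y u (f : V -> R^o) (fu y)) ->
  (forall y, U y -> is_derive y v (fu : V -> R^o) (fuv y)) ->
  (forall a b, 0 <= a <= s -> 0 <= b <= s -> U (x + a *: u + b *: v)) ->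
  exists a b, [/\ 0 <= a <= s, 0 <= b <= s &
   f (x + s *: u + s *: v) - f (x + s *: u) - f (x + s *: v) + f x =
     fuv (x + a *: u + b *: v) * s ^+ 2].
Proof.
move=> s0 df dfu xU.
pose F (r : R) : R := f (x + s *: v + r *: u) - f (x + r *: u).
pose dF r := fu (x + s *: v + r *: u) - fu (x + r *: u).
have Fd r : 0 <= r <= s -> is_derive r 1 (F : R -> R^o) (dF r).
  move=> r0; apply: is_deriveB.
    apply: is_derive_along; apply: df; rewrite addrAC; apply: xU => //.
    by rewrite lexx ltW.
  apply: is_derive_along; apply: df.
  rewrite -[X in U X]addr0 -(scale0r v); apply: xU => //.
  by rewrite lexx ltW.
have [||a aI Fa] := @MVT_segment _ (F : R -> R^o) dF 0 s (ltW s0).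
- move=> r; rewrite in_itv /= => /andP[/ltW r0 /ltW rs].
  by apply: Fd; rewrite r0 rs.
- apply: continuous_in_subspaceT => r; rewrite inE /= in_itv /= => rI.
  by have [dr _] := Fd r rI; exact/differentiable_continuous/derivable1_diffP.
have {}aI : 0 <= a <= s by move: aI; rewrite in_itv.
pose H (r : R) : R := fu (x + a *: u + r *: v).
pose dH r := fuv (x + a *: u + r *: v).
have Hd r : 0 <= r <= s -> is_derive r 1 (H : R -> R^o) (dH r).
  by move=> r0; apply: is_derive_along; apply: dfu; exact: xU.
have [||b bI Hb] := @MVT_segment _ (H : R -> R^o) dH 0 s (ltW s0).
- move=> r; rewrite in_itv /= => /andP[/ltW r0 /ltW rs].
  by apply: Hd; rewrite r0 rs.
- apply: continuous_in_subspaceT => r; rewrite inE /= in_itv /= => rI.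
  by have [dr _] := Hd r rI; exact/differentiable_continuous/derivable1_diffP.
have {}bI : 0 <= b <= s by move: bI; rewrite in_itv.
exists a, b; split => //.
move: Fa Hb; rewrite /F /dF /H /dH !scale0r !addr0 !subr0.
rewrite [x + s *: v + s *: u]addrAC [x + s *: v + a *: u]addrAC => Fa Hb.
rewrite Hb in Fa; rewrite expr2 mulrA -Fa opprB addrA [LHS]addrAC -!addrA.
by congr (_ + _); rewrite addrCA; congr (_ + _); rewrite addrC.
Qed.

(** Schwarz's theorem: the second difference is symmetric in [u] and [v], so on
    arbitrarily small parallelograms the two mixed derivatives share a value,
    and continuity carries the equality to the corner [x]. *)
Lemma scalar_mixed_derivatives (R : realType) (V : normedModType R) (U : set V)
    (f fu fv fuv fvu : V -> R^o) (x u v : V) : open U -> U x ->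
  (forall y, U y -> is_derive y u f (fu y)) ->
  (forall y, U y -> is_derive y v f (fv y)) ->
  (forall y, U y -> is_derive y v fu (fuv y)) ->
  (forall y, U y -> is_derive y u fv (fvu y)) ->
  {for x, continuous fuv} -> {for x, continuous fvu} -> fuv x = fvu x.
Proof.
move=> oU Ux dfu dfv dfuv dfvu cuv cvu.
apply/eqP; rewrite -subr_eq0 -normr_le0; apply/ler_addgt0Pr => e e0.
have e20 : 0 < e / 2 by rewrite divr_gt0.
have near_x (g : V -> R^o) : {for x, continuous g} ->
    \forall y \near x, `|g x - g y| < e / 2.
  by move=> gc; move/cvgrPdist_lt: gc; apply.
have /nbhs_ballP[d d0 xd] : \forall y \near x,
    [/\ U y, `|fuv x - fuv y| < e / 2 & `|fvu x - fvu y| < e / 2].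
  near=> y; split; near: y; [exact: open_nbhs_nbhs|exact: near_x|exact: near_x].
(* The side [s] is small enough for the parallelogram to stay within distance
   [d] of [x]; the summand 1 only keeps [N] positive. *)
pose N := `|u| + `|v| + 1.
have N0 : 0 < N by rewrite ltr_wpDl // addr_ge0.
pose s := d / (2 * N).
have s0 : 0 < s by rewrite divr_gt0 // mulr_gt0.
have inb a b w w' : 0 <= a <= s -> 0 <= b <= s -> `|w| + `|w'| + 1 = N ->
    ball x d (x + a *: w + b *: w').
  move=> /andP[a0 a_le] /andP[b0 b_le] wN.
  rewrite -ball_normE /ball_ /= -addrA opprD addNKr normrN.
  apply: le_lt_trans (ler_normD _ _) _; rewrite !normrZ !ger0_norm //.
  have : a * `|w| + b * `|w'| <= s * N.
    rewrite -wN mulrDr mulr1 mulrDr ler_wpDr ?(ltW s0) //.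
    by apply: lerD; apply: ler_wpM2r.
  move/le_lt_trans; apply; rewrite /s invfM mulrA mulfVK ?gt_eqF //.
  by rewrite ltr_pdivrMr // ltr_pMr // ltr1n.
have [|a [b [aI bI E1]]] := second_difference s0 dfu dfuv (x := x).
  by move=> a b aI bI; have [] := xd _ (inb a b u v aI bI erefl).
have N' : `|v| + `|u| + 1 = N by rewrite (addrC `|v|).
have [|a' [b' [aI' bI' E2]]] := second_difference s0 dfv dfvu (x := x).
  by move=> a' b' aI' bI'; have [] := xd _ (inb a' b' v u aI' bI' N').
have EE : fuv (x + a *: u + b *: v) = fvu (x + a' *: v + b' *: u).
  apply: (mulIf (lt0r_neq0 (exprn_gt0 2 s0))).
  rewrite -E1 -E2 [x + s *: v + s *: u]addrAC.
  by apply: (congr1 (fun z : R => z + f x)); exact: (@addrAC R).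
have [_ + _] := xd _ (inb a b u v aI bI erefl).
have [_ _ ] := xd _ (inb a' b' v u aI' bI' N').
rewrite EE => h1 h2; rewrite add0r (splitr e).
rewrite -(subrKA (fvu (x + a' *: v + b' *: u))).
apply: le_trans (ler_normD _ _) _; rewrite lerD ?ltW // distrC //.
Unshelve. all: by end_near. Qed.

Lemma mixed_derivatives (R : realType) (V : normedModType R) (m n : nat)
    (U : set V) (f : V -> 'M[R]_(m, n)) (x u v : V) :
  open U -> Ck_on 2 U f -> U x -> 'D_u ('D_v f) x = 'D_v ('D_u f) x.
Proof.
move=> oU [df d2f] Ux.
have cd (F : V -> 'M[R]_(m, n)) (y w : V) i j : differentiable F y ->
    is_derive y w (fun z => F z i j : R^o) ('D_w F y i j).
  move=> /diff_derivable - /(_ w) dF; apply: DeriveDef.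
    exact: (derivable_mxP _ _ _).1.
  by rewrite derive_mx // mxE.
have cc w w' i j : {for x, continuous (fun z => 'D_w' ('D_w f) z i j : R^o)}.
  have [_ /(_ w' x Ux) c] := d2f w.
  exact: (cvg_comp _ _ c (@coord_continuous _ _ _ i j _)).
apply/matrixP => i j.
apply: (@scalar_mixed_derivatives _ _ U (fun y => f y i j)
   (fun y => 'D_v f y i j) (fun y => 'D_u f y i j)
   (fun y => 'D_u ('D_v f) y i j) (fun y => 'D_v ('D_u f) y i j)
   x v u) => // y Uy; apply: cd.
- exact: df.
- exact: df.
- by have [+ _] := d2f v; apply.
- by have [+ _] := d2f u; apply.
Qed.

(** * Derivatives of products, pairs and composites along curves *)

Lemma is_derive_scale (R : numFieldType) (W : normedModType R)
    (k : R -> R) (F : R -> W) (t k' : R) (F' : W) :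
  is_derive t (1 : R) (k : R -> R^o) k' -> is_derive t (1 : R) F F' ->
  is_derive t (1 : R) (fun s => k s *: F s) (k' *: F t + k t *: F').
Proof.
move=> [dk <-] [dF <-].
have cF : F (h *: 1 + t) @[h --> 0^'] --> F t.
  have : {for 0, continuous (fun h : R => F (h *: 1 + t))}.
    exact/differentiable_continuous/derivable1_diffP/(derivable1P _ _ _).1.
  by move=> /continuous_withinNx; rewrite scale0r add0r.
have c : (fun h : R => h^-1 *: (((fun s => k s *: F s) \o shift t) (h *: 1)
     - k t *: F t)) @ 0^' --> 'D_1 (k : R -> R^o) t *: F t + k t *: 'D_1 F t.
  have -> : (fun h : R => h^-1 *: (((fun s => k s *: F s) \o shift t) (h *: 1)
     - k t *: F t)) =
      (fun h : R => (h^-1 *: ((k \o shift t) (h *: 1) - k t)) *: F (h *: 1 + t)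
        + k t *: (h^-1 *: ((F \o shift t) (h *: 1) - F t))).
    apply/funext => h /=.
    rewrite (scalerA (k t)) (mulrC (k t)) -(scalerA h^-1 (k t)) -scalerA.
    rewrite -scalerDr; congr (_ *: _).
    by rewrite scalerBr scalerBl subrKA.
  apply: cvgD; apply: cvgZ; [exact: dk|exact: cF|exact: cvg_cst|exact: dF].
by apply: DeriveDef; [apply/cvg_ex; eexists; exact: c|exact: cvg_lim c].
Qed.

(** The product rule for a moving linear map applied to a moving vector. It
    follows from the scalar product rule on the coordinates of [w], so only the
    pointwise derivatives of [A] enter. *)
Lemma is_derive_linear_apply (R : realFieldType) (n : nat) (W : normedModType R)
    (A : R -> 'rV[R]_n -> W) (w : R -> 'rV[R]_n) (t : R)
    (A' : 'rV[R]_n -> W) (w' : 'rV[R]_n) :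
  (\forall s \near t, linear (A s)) ->
  (forall v, is_derive t (1 : R) (A ^~ v) (A' v)) ->
  is_derive t (1 : R) w w' ->
  is_derive t (1 : R) (fun s => A s (w s)) (A' (w t) + A t w').
Proof.
move=> linA dA [dw <-].
have sumA (B : 'rV[R]_n -> W) v : linear B ->
    B v = \sum_(i < n) v 0 i *: B (delta_mx 0 i).
  move=> linB.
  pose lM := GRing.isLinear.Build _ _ _ _ _ linB.
  pose L : {linear _ -> _} := HB.pack B lM.
  rewrite {1}(row_sum_delta v) -[B]/(L : _ -> _) linear_sum.
  by apply: eq_bigr => i _; rewrite linearZ.
have A'E v : A' v = \sum_(i < n) v 0 i *: A' (delta_mx 0 i).
  have [_ <-] := dA v.
  have -> : 'D_1 (A^~ v) t =
      'D_1 (\sum_(i < n) (fun s => v 0 i *: A s (delta_mx 0 i))) t.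
    apply: near_eq_derive; apply: filterS linA => s linAs.
    by rewrite fct_sumE; exact: sumA.
  apply: derive_val.
have dwi i : is_derive t (1 : R) (fun s => w s 0 i : R^o) ('D_1 w t 0 i).
  apply: DeriveDef; first exact: (derivable_mxP _ _ _).1.
  by rewrite derive_mx // mxE.
apply: (@near_eq_is_derive _ _ _
  (\sum_(i < n) (fun s => w s 0 i *: A s (delta_mx 0 i)))).
  by apply: filterS linA => s linAs; rewrite fct_sumE -sumA.
have linAt : linear (A t) by exact: nbhs_singleton linA.
rewrite addrC A'E (sumA (A t)) // -big_split /=.
apply: is_derive_sum => i.
by apply: is_derive_scale.
Qed.

Lemma derive_slicel (R : numFieldType) (V W X : normedModType R)
    (F : V * W -> X) (y v : V) (z : W) :
  'D_v (fun y' => F (y', z)) y = 'D_(v, 0) F (y, z).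
Proof.
rewrite /derive; congr (lim (_ @ 0^')); apply/funext => h /=.
rewrite -[(h *: (v, 0) + (y, z))]/(h *: v + y, h *: (0 : W) + z).
by rewrite scaler0 add0r.
Qed.

Lemma derive_slicer (R : numFieldType) (V W X : normedModType R)
    (F : V * W -> X) (y : V) (z w : W) :
  'D_w (fun z' => F (y, z')) z = 'D_(0, w) F (y, z).
Proof.
rewrite /derive; congr (lim (_ @ 0^')); apply/funext => h /=.
rewrite -[(h *: (0, w) + (y, z))]/(h *: (0 : V) + y, h *: w + z).
by rewrite scaler0 add0r.
Qed.

Lemma derive_linear (R : numFieldType) (V W : normedModType R) (f : V -> W)
    (a : V) : differentiable f a -> linear (fun v => 'D_v f a).
Proof. by move=> df k u v; rewrite !deriveE // linearP. Qed.

Lemma is_derive_comp (R : numFieldType) (V W : normedModType R) (F : V -> W)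
    (f : R -> V) (t : R) (f' : V) : differentiable F (f t) ->
  is_derive t (1 : R) f f' ->
  is_derive t (1 : R) (fun s => F (f s)) ('D_f' F (f t)).
Proof.
move=> dF [/derivable1_diffP df f'E].
have dFf : differentiable (F \o f) t by exact: differentiable_comp.
apply: DeriveDef; first exact/derivable1_diffP.
by rewrite -f'E deriveE // diff_comp //= (deriveE _ df) (deriveE _ dF).
Qed.

Lemma is_derive_pair (R : numFieldType) (V W : normedModType R) (f : R -> V)
    (g : R -> W) (t : R) (f' : V) (g' : W) :
  is_derive t (1 : R) f f' -> is_derive t (1 : R) g g' ->
  is_derive t (1 : R) (fun s => (f s, g s)) (f', g').
Proof.
move=> [/derivable1_diffP df f'E] [/derivable1_diffP dg g'E].
have dp := differentiable_pair df dg.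
apply: DeriveDef; first exact/derivable1_diffP.
by rewrite deriveE // diff_pair // -!deriveE // f'E g'E.
Qed.

(** Used to differentiate an equation between a curve and a constant. *)
Lemma near_constant_is_derive (R : numFieldType) (V : normedModType R)
    (f : R -> V) (t : R) (f' v : V) :
  {near t, f =1 cst v} -> is_derive t (1 : R) f f' -> f' = 0.
Proof. by move=> fv [_ <-]; rewrite (near_eq_derive _ fv) derive_cst. Qed.

(** * Differentials in charts *)

Section LocalRepresentatives.
Context (R : realType).
Implicit Types (V W X : normedModType R) (T U S : Type).

Definition local_rep V W T U (c : chart V T) (d : chart W U) (f : T -> U)
    : V -> W :=
  fun y => cmap d (f (cinv c y)).

(** The charts are arbitrary, not the preferred ones of the atlases, so that
    tangent vectors at varying points can be compared in one chart. The second
    clause lets the chain rule go through an intermediate chart without any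
    mention of the topology of [T] and [U]. *)
Definition chart_diff V W T U (c : chart V T) (d : chart W U) (f : T -> U)
    (x : T) (L : V -> W) : Prop :=
  [/\ csrc c x, \forall y \near cmap c x, csrc d (f (cinv c y)) &
      is_diff (cmap c x) (local_rep c d f) L].

Lemma chart_diff_unique V W T U (c : chart V T) (d : chart W U) f x L L' :
  chart_diff c d f x L -> chart_diff c d f x L' -> L = L'.
Proof. by move=> [_ _ [_ <-]] [_ _ [_ <-]]. Qed.

Lemma chart_near V T (c : chart V T) x : is_chart c -> csrc c x ->
  \forall y \near cmap c x, ctgt c y.
Proof. by move=> [oc ci _] /ci[? _]; exact: open_nbhs_nbhs. Qed.

Lemma chart_diff_img V W T U (c : chart V T) (d : chart W U) f x L :
  is_chart c -> chart_diff c d f x L -> csrc d (f x).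
Proof.
by move=> [_ ci _] [cx + _] => /nbhs_singleton; have [_ ->] := ci x cx.
Qed.

(** Inserting the intermediate chart [d] changes nothing near [x], so this is
    the chain rule between vector spaces. *)
Lemma chart_diff_comp V W X T U S
    (c : chart V T) (d : chart W U) (e : chart X S)
    (f : T -> U) (g : U -> S) x L L' :
  is_chart c -> is_chart d ->
  chart_diff c d f x L -> chart_diff d e g (f x) L' ->
  chart_diff c e (g \o f) x (L' \o L).
Proof.
move=> cc cd [cx fd [df <-]] [dfx ge [dg <-]].
have cdx : local_rep c d f (cmap c x) = cmap d (f x).
  by rewrite /local_rep; have [_ /(_ _ cx)[_ ->] _] := cc.
have fgE : {near cmap c x,
    local_rep d e g \o local_rep c d f =1 local_rep c e (g \o f)}.
  apply: filterS fd => y fy; rewrite /local_rep /=.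
  by have [_ /(_ _ fy)[_ ->] _] := cd.
have dgf : differentiable (local_rep d e g \o local_rep c d f) (cmap c x).
  by apply: differentiable_comp => //; rewrite cdx.
split => //.
  have : \forall y \near cmap c x, csrc e (g (cinv d (local_rep c d f y))).
    have := differentiable_continuous df; rewrite /prop_for /continuous_at cdx.
    by move=> /(_ _ ge).
  apply: filterS2 fd => y fy; rewrite /local_rep /=.
  by have [_ /(_ _ fy)[_ ->] _] := cd.
have dgf' := near_eq_differentiable fgE dgf.
apply: DiffDef => //; apply/funext => v.
by rewrite -deriveE // -(near_eq_derive _ fgE) deriveE // diff_comp ?cdx.
Qed.

Lemma chart_diff_pair V W X T U S
    (c : chart V T) (d : chart W U) (e : chart X S)
    (f : T -> U) (g : T -> S) x L L' :
  chart_diff c d f x L -> chart_diff c e g x L' ->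
  chart_diff c (prod_chart d e) (fun y => (f y, g y)) x (fun v => (L v, L' v)).
Proof.
move=> [cx fd df] [_ ge dg]; split => //; last exact: is_diff_pair.
by apply: filterS2 fd ge.
Qed.

Lemma chart_diff_cst V W T U (c : chart V T) (d : chart W U) x u :
  csrc c x -> csrc d u -> chart_diff c d (fun=> u) x (fun=> 0).
Proof. by move=> cx du; split => //; [near=> y|exact: is_diff_cst]. 
Unshelve. all: by end_near. Qed.

Lemma chart_diff_id V T (c : chart V T) x :
  is_chart c -> csrc c x -> chart_diff c c id x id.
Proof.
move=> cc cx; have tc := chart_near cc cx.
have [_ _ ci] := cc; split => //; first by apply: filterS tc => y /ci[].
have idE : {near cmap c x, id =1 local_rep c c id}.
  by apply: filterS tc => y /ci[_ yE]; rewrite /local_rep yE.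
have did : differentiable (local_rep c c id) (cmap c x).
  exact: (near_eq_differentiable idE).
apply: DiffDef => //; apply/funext => v.
by rewrite -deriveE // -(near_eq_derive _ idE) derive_id.
Qed.

Lemma chart_diff_smooth V W T U (A : atlas V T) (B : atlas W U)
    (c : chart V T) (d : chart W U) (D : set T) (f : T -> U) x :
  smooth_map_on A B D f -> charts A c -> charts B d -> is_chart c ->
  csrc c x -> D x -> csrc d (f x) ->
  chart_diff c d f x ('d (local_rep c d f) (cmap c x)).
Proof.
move=> sf Ac Bd cc cx Dx dfx.
have [oE /(_ 1)[df _]] := sf c d Ac Bd.
have [_ /(_ _ cx)[tx xE] _] := cc.
have Ex : (ctgt c `&` cinv c @^-1` (D `&` f @^-1` csrc d)) (cmap c x).
  by split => //=; rewrite xE.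
split => //.
  have : \forall y \near cmap c x,
      (ctgt c `&` cinv c @^-1` (D `&` f @^-1` csrc d)) y.
    exact: open_nbhs_nbhs.
  by apply: filterS => y [_ []].
by apply: differentiableP; exact: df.
Qed.

Lemma prod_is_chart V W T U (b : chart V T) (d : chart W U) :
  is_chart b -> is_chart d ->
  is_chart (prod_chart b d).
Proof.
move=> [ob b1 b2] [od d1 d2]; split.
- rewrite openE => -[y z] [/= ty tz]; exists (ctgt b, ctgt d) => //=.
  by split; exact: open_nbhs_nbhs.
- by move=> [x y] [/= /b1[? ->] /d1[? ->]].
- by move=> [x y] [/= /b2[? ->] /d2[? ->]].
Qed.

(** The identity chart makes curves a case of [chart_diff]. *)
Definition line_chart : chart R^o R := Chart setT setT id id.

Lemma line_is_chart : is_chart line_chart.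
Proof. by split => //; exact: openT. Qed.

Lemma chart_diff_curve V T (d : chart V T) (h : R -> T) t L :
  chart_diff line_chart d h t L ->
  [/\ csrc d (h t), \forall s \near t, csrc d (h s) &
      is_derive t (1 : R) (fun s => cmap d (h s)) (L 1)].
Proof.
move=> dh; have [_ near_d [dl LE]] := dh.
split => //; first exact: chart_diff_img line_is_chart dh.
apply: DeriveDef; first exact/derivable1_diffP.
by rewrite -LE -deriveE.
Qed.

End LocalRepresentatives.

(** * The adjoint action of a Lie group *)

Section LieGroupCalculus.
Context (R : realType) (n : nat) (G : preTopologicalGroupType).
Variable A : atlas 'rV[R]_n G.
Hypothesis hA : is_lie_group A.
Local Notation V := 'rV[R]_n.

(** [m] is the group law in coordinates around the unit, whose coordinates are
    [x0]. The Lie bracket and the derivative of [Ad] both come out as second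
    derivatives of [m] at [(x0, x0)]. *)
Let c := chart_at A 1%g.
Let x0 := cmap c 1%g.
Definition group_mul (p : G * G) : G := (p.1 * p.2)%g.
Let m := local_rep (prod_chart c c) c group_mul.

Lemma lie_chart d : charts A d -> is_chart d.
Proof. by case: hA => -[_ _ + _ _] _ _; apply. Qed.

Lemma lie_chart_at x : charts A (chart_at A x) /\ csrc (chart_at A x) x.
Proof. by case: hA => -[_ + _ _ _] _ _; apply. Qed.

Lemma chart_diff_mul (W : normedModType R) (T : Type) (a : chart W T)
    (b b' d : chart V G) (f g : T -> G) x L L' :
  is_chart a -> charts A b -> charts A b' -> charts A d ->
  chart_diff a b f x L -> chart_diff a b' g x L' -> csrc d (f x * g x)%g ->
  chart_diff a d (fun y => f y * g y)%g x
    (fun v => 'd (local_rep (prod_chart b b') d group_mul)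
                (cmap b (f x), cmap b' (g x)) (L v, L' v)).
Proof.
move=> ca Ab Ab' Ad df dg dfg.
have bc := prod_is_chart (lie_chart Ab) (lie_chart Ab').
have [_ smul _] := hA.
have dm : chart_diff (prod_chart b b') d group_mul (f x, g x)
    ('d (local_rep (prod_chart b b') d group_mul)
       (cmap (prod_chart b b') (f x, g x))).
  apply: (chart_diff_smooth smul) => //; first by exists b, b'.
  by split; [exact: chart_diff_img ca df|exact: chart_diff_img ca dg].
exact: (chart_diff_comp ca bc (chart_diff_pair df dg) dm).
Qed.

Lemma chart_diff_inv (W : normedModType R) (T : Type) (a : chart W T)
    (b d : chart V G) (f : T -> G) x L :
  is_chart a -> charts A b -> charts A d ->
  chart_diff a b f x L -> csrc d (f x)^-1%g ->
  chart_diff a d (fun y => (f y)^-1)%g x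
    (fun v => 'd (local_rep b d (fun g : G => g^-1%g)) (cmap b (f x)) (L v)).
Proof.
move=> ca Ab Ad df dfi; have [_ _ sinv] := hA.
have di : chart_diff b d (fun g : G => g^-1%g) (f x)
    ('d (local_rep b d (fun g : G => g^-1%g)) (cmap b (f x))).
  apply: (chart_diff_smooth sinv) => //; first exact: lie_chart.
  exact: chart_diff_img ca df.
exact: (chart_diff_comp ca (lie_chart Ab) df di).
Qed.

Let Ac : charts A c. Proof. by case: (lie_chart_at 1%g). Qed.
Let c1 : csrc c 1%g. Proof. by case: (lie_chart_at 1%g). Qed.
Let cc : is_chart c. Proof. exact: lie_chart Ac. Qed.
Let ctgtK y : ctgt c y -> cmap c (cinv c y) = y.
Proof. by case: cc => _ _ + ty => /(_ _ ty)[]. Qed.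
Let cinvS y : ctgt c y -> csrc c (cinv c y).
Proof. by case: cc => _ _ + ty => /(_ _ ty)[]. Qed.
Let cmapK g : csrc c g -> cinv c (cmap c g) = g.
Proof. by case: cc => _ + _ sg => /(_ _ sg)[]. Qed.
Let cmapS g : csrc c g -> ctgt c (cmap c g).
Proof. by case: cc => _ + _ sg => /(_ _ sg)[]. Qed.
Let open_tgt : open (ctgt c). Proof. by case: cc. Qed.

(** The domain on which [m] represents the product. *)
Let Um : set (V * V) :=
  [set p | [/\ ctgt c p.1, ctgt c p.2 & csrc c (cinv c p.1 * cinv c p.2)%g]].

Let m_smooth : open Um /\ forall k, Ck_on k Um m.
Proof.
have [_ smul _] := hA.
have := smul (prod_chart c c) c _ Ac.
have -> : ctgt (prod_chart c c) `&` cinv (prod_chart c c) @^-1`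
     (setT `&` (fun p : G * G => (p.1 * p.2)%g) @^-1` csrc c) = Um.
  by apply/seteqP; split => [[y z] [[/= ? ?] [_ ?]]|[y z] [/= ? ? ?]]; split.
by apply; exists c, c.
Qed.

Let m_diff p : Um p -> differentiable m p.
Proof. by have [_ /(_ 1)[+ _]] := m_smooth; apply. Qed.

Let Dm_diff v p : Um p -> differentiable ('D_v m) p.
Proof. by have [_ /(_ 2)[_ /(_ v)[+ _]]] := m_smooth; apply. Qed.

Let Um_1r y : ctgt c y -> Um (y, x0).
Proof.
by move=> ty; split => //=; [exact: cmapS|rewrite cmapK // mulg1; exact: cinvS].
Qed.

Let Um_1l y : ctgt c y -> Um (x0, y).
Proof.
by move=> ty; split => //=; [exact: cmapS|rewrite cmapK // mul1g; exact: cinvS].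
Qed.

(** By the unit laws the partial maps [m (_, x0)] and [m (x0, _)] are the identity
    on the open set [ctgt c]. *)
Let Dm_1r y v : ctgt c y -> 'D_(v, 0) m (y, x0) = v.
Proof.
move=> ty; rewrite -derive_slicel -[RHS](derive_id y v).
apply: near_eq_derive.
have : \forall y' \near y, ctgt c y' by exact: open_nbhs_nbhs.
apply: filterS => y' ty'.
by rewrite /m /local_rep /group_mul /= cmapK // mulg1 ctgtK.
Qed.

Let Dm_1l y v : ctgt c y -> 'D_(0, v) m (x0, y) = v.
Proof.
move=> ty; rewrite -derive_slicer -[RHS](derive_id y v).
apply: near_eq_derive.
have : \forall y' \near y, ctgt c y' by exact: open_nbhs_nbhs.
apply: filterS => y' ty'.
by rewrite /m /local_rep /group_mul /= cmapK // mul1g ctgtK.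
Qed.

Lemma chart_diff_lmul (b d e : chart V G) k h :
  charts A b -> charts A d -> charts A e ->
  csrc b k -> csrc d h -> csrc e (k * h)%g ->
  chart_diff d e (fun y => k * y)%g h
    (fun v => 'd (local_rep (prod_chart b d) e group_mul)
                (cmap b k, cmap d h) (0, v)).
Proof.
move=> Ab Ad Ae bk dh ekh; have cd := lie_chart Ad.
apply: (chart_diff_mul (f := fun=> k) (g := id)) => //.
  exact: chart_diff_cst.
exact: chart_diff_id.
Qed.

Lemma chart_diff_rmul (b d e : chart V G) k h :
  charts A b -> charts A d -> charts A e ->
  csrc b k -> csrc d h -> csrc e (h * k)%g ->
  chart_diff d e (fun y => y * k)%g h
    (fun v => 'd (local_rep (prod_chart d b) e group_mul)
                (cmap d h, cmap b k) (v, 0)).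
Proof.
move=> Ab Ad Ae bk dh ekh; have cd := lie_chart Ad.
apply: (chart_diff_mul (f := id) (g := fun=> k)) => //.
  exact: chart_diff_id.
exact: chart_diff_cst.
Qed.

(** The tangent vectors produced by [ltrans] are expressed in the preferred
    chart of their base point; this brings them back to [c]. *)
Lemma chart_diff_transition k : csrc c k ->
  let d := chart_at A k in
  chart_diff d c id k ('d (transition d c) (cmap d k)).
Proof.
move=> ck d; have [Ad dk] := lie_chart_at k.
have [[_ _ _ _ /(_ d c Ad Ac)[ot /(_ 1)[dt _]]] _ _] := hA.
have dK : cinv d (cmap d k) = k by case: (lie_chart Ad) => _ /(_ _ dk)[].
have kin : (ctgt d `&` cinv d @^-1` csrc c) (cmap d k).
  by split; [case: (lie_chart Ad) => _ /(_ _ dk)[]|rewrite /= dK].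
split => //; last by apply: differentiableP; exact: dt.
have : \forall z \near cmap d k, (ctgt d `&` cinv d @^-1` csrc c) z.
  exact: open_nbhs_nbhs.
by apply: filterS => z [].
Qed.

Lemma ltrans_chart_diff g h :
  chart_diff (chart_at A h) (chart_at A (g * h)%g) (fun k => g * k)%g h
    (ltrans A g h).
Proof.
have [Ah hh] := lie_chart_at h; have [Ag gg] := lie_chart_at g.
have [Agh ghgh] := lie_chart_at (g * h)%g.
have [? ? [? _]] := chart_diff_lmul Ag Ah Agh gg hh ghgh.
by split.
Qed.

(** In the chart [c], left translation by the point with coordinates [y] is
    [m (y, _)]. *)
Let chart_rep_left_invariant v y : ctgt c y ->
  chart_rep A c (fun g => ltrans A g 1%g v) y = 'D_(0, v) m (y, x0).
Proof.
move=> ty; set k := cinv c y.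
have ck : csrc c k by exact: cinvS.
have ck1 : csrc c (k * 1)%g by rewrite mulg1.
have dL := chart_diff_comp cc (lie_chart (lie_chart_at _).1)
  (ltrans_chart_diff k 1%g) (chart_diff_transition ck1).
have := chart_diff_unique dL (chart_diff_lmul Ac Ac Ac ck c1 ck1).
rewrite /= mulg1 => /(congr1 (fun L => L v)) /= E.
rewrite -[y in RHS](ctgtK ty) -/k deriveE; first exact: E.
by apply: m_diff; apply: Um_1r; exact: cmapS.
Qed.

(** The left invariant field of [eta] has representative
    [y |-> 'D_(0, eta) m (y, x0)], with value [eta] at the unit, so the bracket
    of vector fields is the antisymmetrized mixed second derivative of the group
    law. *)
Lemma lie_bracketE xi eta : lie_bracket A xi eta =
  'D_(xi, 0) ('D_(0, eta) m) (x0, x0) - 'D_(eta, 0) ('D_(0, xi) m) (x0, x0).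
Proof.
have t0 : ctgt c x0 by exact: cmapS.
have E a b : 'd (chart_rep A c (fun g => ltrans A g 1%g a)) x0
    (chart_rep A c (fun g => ltrans A g 1%g b) x0) =
    'D_(b, 0) ('D_(0, a) m) (x0, x0).
  rewrite chart_rep_left_invariant // Dm_1l //.
  have nE : {near x0, (fun y => 'D_(0, a) m (y, x0)) =1
      chart_rep A c (fun g => ltrans A g 1%g a)}.
    have : \forall y \near x0, ctgt c y by exact: open_nbhs_nbhs.
    by apply: filterS => y ty; rewrite chart_rep_left_invariant.
  have dD : differentiable (fun y => 'D_(0, a) m (y, x0)) x0.
    apply: (differentiable_comp (f := fun y => (y, x0)) (g := 'D_(0, a) m)).
      exact: differentiable_pair.
    exact: Dm_diff (Um_1r t0).
  rewrite -deriveE; last exact: near_eq_differentiable nE dD.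
  by rewrite -(near_eq_derive _ nE); exact: (derive_slicel ('D_(0, a) m)).
exact: (f_equal2 (fun u v => u - v) (E eta xi) (E xi eta)).
Qed.

Let t0 : ctgt c x0. Proof. exact: cmapS. Qed.

Lemma lie_bracket_linear xi : linear (lie_bracket A xi).
Proof.
move=> k u v; rewrite !lie_bracketE.
have nU : \forall p \near (x0, x0), Um p.
  by have [oU _] := m_smooth; apply: open_nbhs_nbhs; split => //; exact: Um_1r.
have E : 'D_(xi, 0) ('D_(0, k *: u + v) m) (x0, x0) =
    k *: 'D_(xi, 0) ('D_(0, u) m) (x0, x0) + 'D_(xi, 0) ('D_(0, v) m) (x0, x0).
  have dD w : derivable ('D_(0, w) m) (x0, x0) (xi, 0).
    by apply: diff_derivable; apply: Dm_diff; exact: Um_1r.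
  rewrite -deriveZ // -deriveD //; last exact: derivableZ.
  apply: near_eq_derive; apply: filterS nU => p Up.
  have -> : (0, k *: u + v) = k *: (0, u) + (0, v) :> V * V.
    by congr pair; rewrite /= scaler0 addr0.
  exact: derive_linear (m_diff Up) k (0, u) (0, v).
have E' : 'D_(k *: u + v, 0) ('D_(0, xi) m) (x0, x0) =
    k *: 'D_(u, 0) ('D_(0, xi) m) (x0, x0) + 'D_(v, 0) ('D_(0, xi) m) (x0, x0).
  rewrite -(derive_linear (Dm_diff (0, xi) (Um_1r t0)) k (u, 0) (v, 0)).
  by congr derive; congr pair; rewrite /= scaler0 addr0.
have lin (a b a' b' : V) : (k *: a + b) - (k *: a' + b') =
    k *: (a - a') + (b - b') by rewrite scalerBr opprD addrACA.
exact: etrans (f_equal2 (fun a b => a - b) E E') (lin _ _ _ _).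
Qed.

Lemma conj_chart_diff g : chart_diff c c (fun h => g * h * g^-1)%g 1%g (Ad A g).
Proof.
have [Ag gg] := lie_chart_at g; have [Ai ii] := lie_chart_at g^-1%g.
have gg1 : csrc (chart_at A g) (g * 1)%g by rewrite mulg1.
have cg : csrc c (g * 1 * g^-1)%g by rewrite mulg1 mulgV.
have [p1 p2 [d _]] := chart_diff_mul cc Ag Ai Ac
  (chart_diff_lmul Ag Ac Ag gg c1 gg1) (chart_diff_cst c1 ii) cg.
have E : chart_at A (g * 1 * g^-1)%g = c by rewrite mulg1 mulgV.
split; [exact: p1|exact: p2|apply: DiffDef; first exact: d].
rewrite /Ad /tangent_map E; reflexivity.
Qed.

Lemma AdM g h v : Ad A (g * h)%g v = Ad A g (Ad A h v).
Proof.
have dg : chart_diff c c (fun k => g * k * g^-1)%g (h * 1 * h^-1)%g (Ad A g).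
  by rewrite mulg1 mulgV; exact: conj_chart_diff.
have := chart_diff_comp cc cc (conj_chart_diff h) dg.
have -> : (fun k => g * k * g^-1)%g \o (fun k => h * k * h^-1)%g =
    (fun k => (g * h) * k * (g * h)^-1)%g.
  by apply/funext => k /=; rewrite invgM !mulgA.
by move=> /(chart_diff_unique (conj_chart_diff _)) ->.
Qed.

(** Conjugation by the inverse of [k] is [y |-> k^-1 * (y * k)]: two successive
    group laws, hence two partial differentials of [m]. *)
Let Ad_inv_local k v : csrc c k -> csrc c k^-1%g ->
  Ad A k^-1%g v =
  'd m (cmap c k^-1%g, cmap c k) (0, 'D_(v, 0) m (x0, cmap c k)).
Proof.
move=> ck cki; rewrite deriveE; last first.
  by apply: m_diff; apply: Um_1l; exact: cmapS.
have ck1 : csrc c (1 * k)%g by rewrite mul1g.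
have ckk : csrc c (k^-1 * (1 * k))%g by rewrite mul1g mulVg.
have := chart_diff_comp cc cc (chart_diff_rmul Ac Ac Ac ck c1 ck1)
  (chart_diff_lmul Ac Ac Ac cki ck1 ckk).
have -> : (fun y => k^-1 * y)%g \o (fun y => y * k)%g =
    (fun h => k^-1 * h * k^-1^-1)%g.
  by apply/funext => h /=; rewrite invgK mulgA.
move=> /(chart_diff_unique (conj_chart_diff _)) ->.
by rewrite /= mul1g.
Qed.

(** The infinitesimal form of the adjoint action, for a curve through the unit.
    With [x] and [j] the coordinates of [h] and of its inverse,
    [Ad (h s)^-1 v] is [B s (w s)], where [w s] is the right translate of [v] by
    [h s] and [B s] the left translation by the inverse of [h s]. The derivative
    of [w] is a mixed derivative of [m] in the order opposite to that of
    [lie_bracketE], so it is Schwarz's theorem that identifies the two. *)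
Lemma is_derive_Ad_inv_at_one (h : R -> G) t L v :
  h t = 1%g -> chart_diff (line_chart R) c h t L ->
  is_derive t (1 : R) (fun s => Ad A (h s)^-1%g v) (- lie_bracket A (L 1) v).
Proof.
move=> ht dh.
have ci : csrc c (h t)^-1%g by rewrite ht invg1; exact: c1.
have [_ near_h dx] := chart_diff_curve dh.
have [_ near_i dj] :=
  chart_diff_curve (chart_diff_inv (line_is_chart R) Ac Ac dh ci).
move: dx dj; set xi := L 1; set j' := 'd _ _ _.
set x := fun s => cmap c (h s); set j := fun s => cmap c (h s)^-1%g => dx dj.
have xt : x t = x0 by rewrite /x ht.
have jt : j t = x0 by rewrite /j ht invg1.
have U0 : Um (x0, x0) by exact: Um_1r.
have D0 u w : 'D_(u, w) m (x0, x0) = u + w.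
  rewrite -[u in RHS](Dm_1r u t0) -[w in RHS](Dm_1l w t0).
  rewrite !(deriveE _ (m_diff U0)) -linearD; congr ('d _ _ _).
  by congr pair; rewrite /= ?addr0 ?add0r.
(* Differentiate [m (x s, j s) = x0]. *)
have j'E : j' = - xi.
  have dm : is_derive t (1 : R) (fun s => m (x s, j s)) (xi + j').
    rewrite -D0 -{1}xt -{1}jt.
    apply: is_derive_comp (is_derive_pair dx dj).
    by rewrite xt jt; exact: m_diff.
  apply/eqP; rewrite -addr_eq0 addrC; apply/eqP.
  apply: (near_constant_is_derive (v := x0)) dm.
  apply: filterS2 near_h near_i => s hs inv_s.
  by rewrite /m /local_rep /group_mul /= !cmapK // mulgV.
have near_U : \forall s \near t, Um (j s, x s).
  apply: filterS2 near_h near_i => s hs inv_s.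
  split; [exact: cmapS|exact: cmapS|].
  by rewrite /= !cmapK // mulVg; exact: c1.
pose w s := 'D_(v, 0) m (x0, x s).
have dw : is_derive t (1 : R) w ('D_(0, xi) ('D_(v, 0) m) (x0, x0)).
  rewrite -{2}xt.
  apply: is_derive_comp (is_derive_pair (is_derive_cst x0 t 1) dx).
  by rewrite xt; exact: Dm_diff.
pose B s u := 'd m (j s, x s) (0, u).
have linB s : linear (B s).
  move=> k a b; rewrite /B -linearP; congr ('d _ _ _).
  by congr pair; rewrite /= scaler0 addr0.
have dB u : is_derive t (1 : R) (B ^~ u) (- 'D_(xi, 0) ('D_(0, u) m) (x0, x0)).
  apply: (@near_eq_is_derive _ _ _ (fun s => 'D_(0, u) m (j s, x s))).
    by apply: filterS near_U => s Us; exact: deriveE (m_diff Us).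
  have dF : differentiable ('D_(0, u) m) (j t, x t).
    by rewrite jt xt; exact: Dm_diff.
  apply: is_derive_eq (is_derive_comp dF (is_derive_pair dj dx)) _.
  rewrite jt xt -/j' j'E.
  (* [y |-> 'D_(0, u) m (x0, y)] is constant near [x0], being a left
     translation by the unit: only the motion of [j] contributes. *)
  have right0 : 'D_(0, xi) ('D_(0, u) m) (x0, x0) = 0.
    rewrite -[RHS](derive_cst u x0 xi).
    rewrite -(derive_slicer ('D_(0, u) m)); apply: near_eq_derive.
    have : \forall y \near x0, ctgt c y by exact: open_nbhs_nbhs.
    by apply: filterS => y ty; exact: Dm_1l.
  have split_dir : (- xi, xi) = (-1) *: (xi, 0) + (0, xi) :> V * V.
    by congr pair; rewrite /= scaleN1r ?addr0 ?oppr0 ?add0r.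
  rewrite split_dir.
  apply: etrans (derive_linear (Dm_diff (0, u) U0) (-1) (xi, 0) (0, xi)) _.
  by rewrite right0 addr0 scaleN1r.
have wt : w t = v by rewrite /w xt; exact: Dm_1r.
have Bt u : B t u = u.
  rewrite /B jt xt -[RHS](Dm_1l u t0); exact: esym (deriveE _ (m_diff U0)).
have sym : 'D_(0, xi) ('D_(v, 0) m) (x0, x0) =
    'D_(v, 0) ('D_(0, xi) m) (x0, x0).
  by have [oU sm] := m_smooth; exact: mixed_derivatives oU (sm 2) U0.
apply: (@near_eq_is_derive _ _ _ (fun s => B s (w s))).
  apply: filterS3 near_h near_i near_U => s hs inv_s _.
  exact: esym (Ad_inv_local _ hs inv_s).
have linBt : \forall s \near t, linear (B s).
  by apply: filterS near_U => s _; exact: linB.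
apply: is_derive_eq (is_derive_linear_apply linBt dB dw) _.
rewrite wt.
apply: etrans (f_equal2 (fun a b => a + b) erefl (etrans (Bt _) sym)) _.
apply: etrans (f_equal -%R (esym (lie_bracketE xi v))).
by rewrite opprB addrC.
Qed.

(** [Ad] is multiplicative, so [g s] may be replaced by [g(t)^-1 g(s)], a curve
    through the unit whose velocity is the left trivialized velocity of [g]. *)
Lemma is_derive_Ad_inv (D : set R) (g : R -> G) t v :
  smooth_map_on (vec_atlas R^o) A D g -> D t ->
  is_derive t (1 : R) (fun s => Ad A (g s)^-1%g v)
    (- lie_bracket A (ltrans A (g t)^-1%g (g t) (velocity A g t))
                   (Ad A (g t)^-1%g v)).
Proof.
move=> sg Dt; have [Ag gg] := lie_chart_at (g t).
have dg : chart_diff (line_chart R) (chart_at A (g t)) g t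
    ('d (local_rep (line_chart R) (chart_at A (g t)) g) t).
  by apply: (chart_diff_smooth sg) => //; exact: (line_is_chart R).
have dl : chart_diff (chart_at A (g t)) c (fun k => (g t)^-1 * k)%g (g t)
    (ltrans A (g t)^-1%g (g t)).
  by have := ltrans_chart_diff (g t)^-1%g (g t); rewrite mulVg.
have dh := chart_diff_comp (line_is_chart R) (lie_chart Ag) dg dl.
have -> : (fun s => Ad A (g s)^-1%g v) =
    (fun s => Ad A ((g t)^-1 * g s)^-1%g (Ad A (g t)^-1%g v)).
  by apply/funext => s; rewrite -AdM invgM invgK mulgK.
have vE : velocity A g t =
    'd (local_rep (line_chart R) (chart_at A (g t)) g) t 1.
  by have [_ _ [dgt _]] := dg; exact: derive1E' dgt.
rewrite vE.
exact: is_derive_Ad_inv_at_one (mulVg (g t)) dh.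
Qed.

End LieGroupCalculus.

(** * Pairings and the Kelvin-Noether theorem *)

Lemma pairing_is_linear (R : realType) n (alpha : 'cV[R]_n) :
  linear (pairing alpha : _ -> R^o).
Proof. by move=> k u v; rewrite /pairing mulmxDl -scalemxAl !mxE. Qed.

Lemma pairingDl (R : realType) n (alpha beta : 'cV[R]_n) v :
  pairing (alpha + beta) v = pairing alpha v + pairing beta v.
Proof. by rewrite /pairing mulmxDr !mxE. Qed.

Lemma pairingNr (R : realType) n (alpha : 'cV[R]_n) v :
  pairing alpha (- v) = - pairing alpha v.
Proof. by rewrite /pairing mulNmx !mxE. Qed.

Lemma pairing_covector (R : realType) n (f : 'rV[R]_n -> R) v :
  linear (f : _ -> R^o) -> pairing (covector f) v = f v.
Proof.
move=> linf.
pose lM := GRing.isLinear.Build _ _ _ _ _ linf.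
pose F : {linear _ -> _} := HB.pack (f : _ -> R^o) lM.
rewrite [in RHS](row_sum_delta v) -[f]/(F : _ -> _) linear_sum /pairing mxE.
by apply: eq_bigr => i _; rewrite mxE linearZ.
Qed.

Lemma pairing_ad_star (R : realType) n (G : preTopologicalGroupType)
    (A : atlas 'rV[R]_n G) xi mu v : is_lie_group A ->
  pairing (ad_star A xi mu) v = pairing mu (lie_bracket A xi v).
Proof.
move=> hA; apply: pairing_covector => k u w.
by rewrite (lie_bracket_linear hA) pairing_is_linear.
Qed.

Lemma is_derive_pairing (R : realType) n (mu : R -> 'cV[R]_n)
    (w : R -> 'rV[R]_n) t mu' w' :
  is_derive t (1 : R) mu mu' -> is_derive t (1 : R) w w' ->
  is_derive t (1 : R) (fun s => pairing (mu s) (w s) : R^o)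
    (pairing mu' (w t) + pairing (mu t) w').
Proof.
move=> [dmu <-] dw.
apply: (is_derive_linear_apply (A := fun s v => pairing (mu s) v : R^o)
  (A' := fun v => pairing ('D_1 mu t) v)) dw.
  by apply: (@filterE _ (nbhs t)) => s; exact: pairing_is_linear.
move=> v.
have dmui i : is_derive t (1 : R) (fun s => mu s i 0 : R^o) ('D_1 mu t i 0).
  apply: DeriveDef; first exact: (derivable_mxP _ _ _).1.
  by rewrite derive_mx // mxE.
have -> : (fun s => pairing (mu s) v : R^o) =
    \sum_(i < n) (v 0 i \*: (fun s => mu s i 0 : R^o)).
  by apply/funext => s; rewrite fct_sumE /pairing mxE.
by rewrite /pairing mxE; apply: is_derive_sum => i; exact: is_deriveZ.
Qed.

Theorem corollary1p6
  (R : realType)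
  (n : nat) (G : preTopologicalGroupType) (AG : atlas 'rV[R]_n G)
  (hG : is_lie_group AG)
  (m : nat) (M : topologicalType) (AM : atlas 'rV[R]_m M)
  (hM : is_manifold AM)
  (phiM : left_action G M) (hactM : smooth_action AG AM phiM)
  (a_ref : M)
  (Orb := orbit_type phiM a_ref)
  (AOrb := orbit_atlas AG AM phiM a_ref)
  (phiOrb := orbit_action phiM a_ref)
  (L : G * 'rV[R]_n * R -> R)
  (hL : smooth_map (TGR_atlas AG) (vec_atlas R^o) L)
  (hLinv : invariant_map AG phiM a_ref L)
  (Fext Ffr : G * 'rV[R]_n * R -> G * 'cV[R]_n)
  (hFext : smooth_map (TGR_atlas AG) (cotangent_atlas AG) Fext)
  (hFextfib : fiber_preserving Fext)
  (hFexteq : equivariant_force AG phiM a_ref Fext)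
  (hFfr : smooth_map (TGR_atlas AG) (cotangent_atlas AG) Ffr)
  (hFfrfib : fiber_preserving Ffr)
  (hFfreq : equivariant_force AG phiM a_ref Ffr)
  (P : G * 'rV[R]_n * R -> R)
  (hP : smooth_map (TGR_atlas AG) (vec_atlas R^o) P)
  (hPinv : invariant_map AG phiM a_ref P)
  (l : 'rV[R]_n * Orb * R -> R) (hl : reduced_map AG L l)
  (fext ffr : 'rV[R]_n * Orb * R -> 'cV[R]_n)
  (hfext : reduced_force AG Fext fext) (hffr : reduced_force AG Ffr ffr)
  (p : 'rV[R]_n * Orb * R -> R) (hp : reduced_map AG P p)
  (k : nat) (C : topologicalType) (AC : atlas 'rV[R]_k C)
  (hC : is_manifold AC)
  (phiC : left_action G C) (hactC : smooth_action AG AC phiC)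
  (K : C * Orb -> 'rV[R]_n)
  (hK : smooth_map (prod_atlas AC AOrb) (vec_atlas 'rV[R]_n) K)
  (hKeq : forall (g : G) (c : C) (a : Orb),
     K (phiC g c, phiOrb g a) = Ad AG g (K (c, a)))
  (c_ref : C)
  (D : set R) (hDopen : open D) (hDint : is_interval D)
  (g : R -> G) (xi : R -> 'rV[R]_n) (a : R -> Orb) (S : R -> R)
  (hg : smooth_map_on (vec_atlas R^o) AG D g)
  (hS : smooth_map_on (vec_atlas R^o) (vec_atlas R^o) D S)
  (hxi : forall t, D t -> xi t = ltrans AG (g t)^-1%g (g t) (velocity AG g t))
  (ha : forall t, D t -> a t = orbit_pt phiM a_ref (g t)^-1%g)
  (J := fun t => momentum_map AG AOrb phiOrb (a t)
                   (partial_a AOrb l (xi t) (a t) (S t)))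
  (hmom : forall t, D t ->
     is_derive t (1 : R) (fun u => partial_xi l (xi u) (a u) (S u))
       (ad_star AG (xi t) (partial_xi l (xi t) (a t) (S t)) - J t
        + fext (xi t, a t, S t) + ffr (xi t, a t, S t)))
  (hent : forall t, D t ->
     partial_S l (xi t) (a t) (S t) * derive1 (S : R -> R^o) t
       = pairing (ffr (xi t, a t, S t)) (xi t) - p (xi t, a t, S t))
  (hadv : forall t, D t ->
     velocity AM (fun u => sval (a u)) t
       + generator AG AM phiM (xi t) (sval (a t)) = 0)
  (c : R -> C) (hc : forall t, D t -> c t = phiC (g t)^-1%g c_ref) :
  forall t, D t ->
    is_derive t (1 : R)
      (fun u => kelvin_noether l K (c u) (xi u) (a u) (S u))
      (pairing (- J t + (fext (xi t, a t, S t) + ffr (xi t, a t, S t)))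
               (K (c t, a t))).
Proof.
move=> t Dt.
pose kappa := K (c_ref, orbit_pt phiM a_ref 1%g).
(* [c u] and [a u] are the translates of the reference points by the inverse of
   [g u], so equivariance reduces [K] to the adjoint orbit of [kappa]. *)
have KE u : D u -> K (c u, a u) = Ad AG (g u)^-1%g kappa.
  move=> Du; rewrite -hKeq hc // ha //; congr (K (_, _)).
  apply: eq_sig_hprop => [x p1 p2|] /=; first exact: Prop_irrelevance.
  by rewrite act1.
have nD : \forall u \near t, D u by exact: open_nbhs_nbhs.
apply: (@near_eq_is_derive _ _ _ (fun u =>
    pairing (partial_xi l (xi u) (a u) (S u))
    (Ad AG (g u)^-1%g kappa) : R^o)).
  by apply: filterS nD => u Du; rewrite /kelvin_noether KE.
apply: is_derive_eq
  (is_derive_pairing (hmom t Dt) (is_derive_Ad_inv hG kappa hg Dt)) _.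
rewrite -KE // -hxi // pairingNr !pairingDl pairing_ad_star //.
by rewrite -!addrA addrC -!addrA addNr addr0.
Qed.
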